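(* Let $(X,\mathcal B,\mu)$ be a probability space and let $T:X\to X$ be a measure-preserving and ergodic transformation. Let $\{A_n\}_{n\ge 1}\subset\mathcal B$ be a sequence of sets of positive measure with $\lim_{n\to\infty}\mu(A_n)=0$. Then the following statements are equivalent. (1) The distribution of the normalized return time $\mu(A_n)\tau_{A_n}$ on $(A_n,\mu_{A_n})$ converges, as $n\to\infty$, to the exponential distribution with parameter $1$. (2) The distribution of the normalized hitting time $\mu(A_n)\tau_{A_n}$ on $(X,\mu)$ converges, as $n\to\infty$, to the exponential distribution with parameter $1$. (3) For every $t>0$, $$\lim_{n\to\infty}\bigl(1-e^{-\mu(A_n)t}\bigr)\sum_{k=0}^\infty e^{-\mu(A_n)kt}\,\tilde{s}_{A_n}(k)=\frac{t}{t+1}.$$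
   Context: For a measurable set $A$ with $\mu(A)>0$, $\tau_A(x):=\inf\{k\ge 1: T^k(x)\in A\}$ (called the return time when considered on $A$, the hitting time when considered on $X$; it is finite almost everywhere), and $\mu_A:=\mu|_A/\mu(A)$ is the normalized restriction of $\mu$ to $A$. The sweep-out sequence of $A$ is $\tilde{s}_A(0):=1$ and $\tilde{s}_A(k):=\mu(A^c\cap T^{-1}A^c\cap\cdots\cap T^{-k+1}A^c)$ for $k\ge 1$. Convergence of distributions means weak convergence (convergence in distribution). *)

(* Defs.v *)
From HB Require Import structures.
From mathcomp Require Import all_boot all_order all_algebra.
From mathcomp Require Import all_classical all_reals all_analysis.
From mathcomp Require Import measurable_realfun exponential_distribution.

Set Implicit Arguments.
Unset Strict Implicit.
Unset Printing Implicit Defensive.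

Import Order.TTheory GRing.Theory Num.Theory.
Import numFieldNormedType.Exports.

Local Open Scope classical_set_scope.
Local Open Scope ring_scope.

Definition measure_preserving (d : measure_display) (X : measurableType d)
    (R : realType) (mu : probability X R) (T : X -> X) : Prop :=
  forall B : set X, measurable B -> mu (T @^-1` B) = mu B.

Definition ergodic (d : measure_display) (X : measurableType d)
    (R : realType) (mu : probability X R) (T : X -> X) : Prop :=
  forall B : set X, measurable B -> T @^-1` B = B -> mu B = 0%E \/ mu B = 1%E.

(* The infimum of the empty set is +oo. *)
Definition hitting_time (R : realType) (X : Type) (T : X -> X) (A : set X)
    (x : X) : \bar R :=
  ereal_inf [set k%:R%:E | k in [set k : nat | (1 <= k)%N /\ A (iter k T x)]].

Definition sweep_out (d : measure_display) (X : measurableType d)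
    (R : realType) (mu : probability X R) (T : X -> X) (A : set X) (k : nat) :
    \bar R :=
  if k is 0%N then 1%E else mu (\bigcap_(i < k) (iter i T @^-1` ~` A)).

(* When mu A > 0 this is B |-> mu (B `&` A) / mu A; the second argument of
   [mnormalize] is a default value, used only when mu A = 0. *)
Definition normalized_restriction (d : measure_display)
    (X : measurableType d) (R : realType) (mu : probability X R) (A : set X)
    (mA : measurable A) : probability X R :=
  mnormalize (mrestr mu mA) mu.

(* For ergodic T and mu A > 0 the hitting time is +oo only on a null set,
   where [fine] returns 0; this does not affect the distribution.
   The argument mA only serves to infer the measurability of the function. *)
Definition normalized_hitting_time (d : measure_display)
    (X : measurableType d) (R : realType) (mu : probability X R)
    (T : {mfun X >-> X}) (A : set X) (mA : measurable A) (x : X) :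
    measurableTypeR R :=
  fine (mu A * hitting_time R T A x)%E.

Section measurable_normalized_hitting_time.
Context (d : measure_display) (X : measurableType d) (R : realType).
Variables (mu : probability X R) (T : {mfun X >-> X}).
Variables (A : set X) (mA : measurable A).

Lemma measurable_iter (k : nat) : measurable_fun [set: X] (iter k T).
Proof.
elim: k => [|k IH]; first exact: measurable_id.
by apply: (measurableT_comp _ IH).
Qed.

Lemma measurable_hitting_time :
  measurable_fun [set: X] (hitting_time R T A : X -> \bar R).
Proof.
pose h (k : nat) (x : X) : \bar R :=
  (if x \in iter k.+1 T @^-1` A then k.+1%:R%:E else +oo)%E.
have mh k : measurable_fun [set: X] (h k).
  have mk : measurable (iter k.+1 T @^-1` A).
    by rewrite -[X in measurable X]setTI; exact: measurable_iter.
  apply: measurable_fun_if => //.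
  by apply: (measurable_fun_bool true); rewrite setTI preimage_mem_true.
rewrite (_ : hitting_time R T A = fun x => einfs (h ^~ x) 0%N); last first.
  apply/funext => x; apply/eqP; rewrite eq_le; apply/andP; split.
    apply: le_ereal_inf_tmp => _ [k _ <-]; rewrite /h.
    case: ifPn => [/set_mem/= Ak|_]; last by rewrite leey.
    by apply: ereal_inf_lbound; exists k.+1.
  apply: le_ereal_inf_tmp => _ [[|k] []// _ Ak <-].
  apply: ereal_inf_lbound; exists k => //; rewrite /h ifT//.
  exact/mem_set.
exact: measurable_fun_einfs.
Qed.

Let measurable_nht : measurable_fun [set: X] (normalized_hitting_time mu T mA).
Proof.
apply: measurableT_comp => //.
apply: emeasurable_funM => //.
exact: measurable_hitting_time.
Qed.

HB.instance Definition _ := isMeasurableFun.Build _ _ _ _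
  (normalized_hitting_time mu T mA) measurable_nht.

End measurable_normalized_hitting_time.

(* The law with density [exponential_pdf 1]. Its instance of probability is
   named explicitly because the positivity of the rate cannot be inferred. *)
Definition standard_exponential (R : realType) :
    probability (measurableTypeR R) R :=
  exponential_distribution_exponential_prob__canonical__probability_measure_Probability
    (@ltr01 R).

Definition weak_cvg (R : realType)
    (P_ : nat -> probability (measurableTypeR R) R)
    (P : probability (measurableTypeR R) R) : Prop :=
  forall f : R -> R, continuous f -> bounded_fun f ->
  (\int[P_ n]_x (f x)%:E)%E @[n --> \oo] --> (\int[P]_x (f x)%:E)%E.

(* Main.v *)
Require Import Defs.
From mathcomp Require Import all_boot all_order all_algebra.
From mathcomp Require Import all_classical all_reals all_analysis.
From mathcomp Require Import measurable_realfun exponential_distribution.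
From mathcomp Require Import ring lra.

(* Laplace transforms determine weak convergence on the half line. Write
   m = mu A, q = exp (- m t) and tau for the hitting time of A. For a law nu
   under which tau is almost surely finite, summing a geometric series gives
     1 - E_nu[exp (- t m tau)] = (1 - q) \sum_k q^k nu(tau > k).
   By invariance mu(tau > k) is the sweep-out s(k), so for nu = mu the right
   side is the quantity in (3), which thus is a statement on the transform H of
   the hitting time. Since mu(A, tau > k) = s(k) - s(k+1), the transform L of
   the return time is L = 1 - ((exp (m t) - 1) / m) H. When m tends to 0 the
   slope tends to t, and 1 / (1 + t) is the fixed point of x |-> 1 - t x, so L
   tends to 1 / (1 + t) if and only if H does. *)

Set Implicit Arguments.
Unset Strict Implicit.
Unset Printing Implicit Defensive.

Import Order.TTheory GRing.Theory Num.Theory.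
Import numFieldNormedType.Exports.

Local Open Scope classical_set_scope.
Local Open Scope ring_scope.

(** * Weierstrass approximation *)

(* The expectation of [g k] for [k] binomial with parameters [n] and ['X], by
   conditioning on the first toss. *)
Fixpoint bernstein (R : nzRingType) (n : nat) (g : nat -> R) : {poly R} :=
  if n is m.+1 then
    'X * bernstein m (fun k => g k.+1) + (1 - 'X) * bernstein m g
  else (g 0%N)%:P.

Lemma bernsteinS (R : comNzRingType) (n : nat) (g : nat -> R) (u : R) :
  (bernstein n.+1 g).[u] =
  u * (bernstein n (fun k => g k.+1)).[u] + (1 - u) * (bernstein n g).[u].
Proof. by rewrite /= !hornerE. Qed.

(** Linearity of the expectation; the constant [b] passes through because the binomial weights add
    up to 1. *)
Lemma bernstein_affine (R : comNzRingType) (n : nat) (a b : R) (g : nat -> R)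
    (u : R) :
  (bernstein n (fun k => a * g k + b)).[u] = a * (bernstein n g).[u] + b.
Proof.
by elim: n g => [|n IH] g; [rewrite /= !hornerE|rewrite !bernsteinS !IH; ring].
Qed.

(** Both weights [u] and [1 - u] are nonnegative. The comparison is asked only for [k <= n], the
    range of the binomial variable. *)
Lemma ler_bernstein (R : numDomainType) (n : nat) (g1 g2 : nat -> R) (u : R) :
  0 <= u <= 1 -> (forall k, (k <= n)%N -> g1 k <= g2 k) ->
  (bernstein n g1).[u] <= (bernstein n g2).[u].
Proof.
move=> /andP[u0 u1]; elim: n g1 g2 => [|n IH] g1 g2 g12.
  by rewrite /= !hornerE g12.
rewrite !bernsteinS lerD// ler_wpM2l ?subr_ge0// IH// => k kn; apply: g12 => //.
exact: ltnW.
Qed.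

(** Squared bias plus binomial variance. The center [a] is arbitrary because a success on the first
    toss shifts [k] by one, which the induction absorbs in [a]. *)
Lemma bernstein_sqr (R : comNzRingType) (n : nat) (a u : R) :
  (bernstein n (fun k => (k%:R - a) ^+ 2)).[u] =
  (n%:R * u - a) ^+ 2 + n%:R * (u * (1 - u)).
Proof.
elim: n a => [|n IH] a; first by rewrite /= !hornerE.
rewrite bernsteinS (_ : (fun k => _) = fun k => (k%:R - (a - 1)) ^+ 2).
  by rewrite !IH -natr1; ring.
by apply/funext => k; rewrite -natr1; ring.
Qed.

(** Local moduli become uniform by compactness in its near-covering form. Only [x] is confined to
    [K]; [y] may leave it. *)
Lemma compact_unif_continuous (R : realType) (K : set R) (f : R -> R) (e : R) :
  compact K -> continuous f -> 0 < e ->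
  exists2 d : R, 0 < d &
    forall x y : R, K x -> `|x - y| < d -> `|f x - f y| < e.
Proof.
move=> /compact_near_coveringP cK cf e0.
have /cK : forall x, K x -> \forall x' \near x & d \near (0:R)^'+,
    forall y, `|x' - y| < d -> `|f x' - f y| < e.
  move=> x Kx.
  have e20 : 0 < e / 2 by rewrite divr_gt0.
  have /cvgrPdist_lt/(_ _ e20)/nbhs_ballP[r r0 fr] := cf x.
  have r20 : 0 < r / 2 by rewrite divr_gt0.
  near=> x' d => y x'y.
  have xx' : `|x - x'| < r / 2 by near: x'; exact: (nbhsx_ballx x _ r20).
  have dr : d < r / 2 by near: d; exact: nbhs_right_lt.
  have h1 : `|f x - f x'| < e / 2.
    by apply: fr; rewrite /ball/= (lt_trans xx')//; lra.
  have h2 : `|f x - f y| < e / 2.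
    apply: fr; rewrite /ball/= (le_lt_trans (ler_distD x' _ _))//.
    by rewrite [ltRHS]splitr ltrD// (lt_trans x'y).
  by rewrite (le_lt_trans (ler_distD (f x) _ _))// [ltRHS]splitr ltrD// distrC.
move=> H.
near (0:R)^'+ => d.
exists d; first by near: d; exact: nbhs_right_gt.
move=> x y Kx; move: x Kx y.
near: d.
exact: H.
Unshelve. all: by end_near. Qed.

(** Bernstein's proof: where [k / N] is within [d] of [u], uniform continuity bounds the error;
    elsewhere a quadratic dominates it, as in Chebyshev's inequality, and the expectation of the
    quadratic is of order [1 / N]. *)
Lemma weierstrass_approx (R : realType) (f : R -> R) (e : R) :
  continuous f -> 0 < e ->
  exists p : {poly R}, forall u : R, 0 <= u <= 1 -> `|f u - p.[u]| <= e.
Proof.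
move=> cf e0.
have cI := @segment_compact R 0 1.
have [M M0 fM] : exists2 M : R,
    0 < M & forall u : R, 0 <= u <= 1 -> `|f u| <= M.
  have [M [Mr HM]] := compact_bounded (continuous_compact
    (continuous_subspaceT cf) cI).
  exists (`|M| + 1); first by rewrite ltr_wpDl.
  move=> u u01; apply: (HM (`|M| + 1)).
    by rewrite (le_lt_trans (ler_norm _))// ltrDl.
  by exists u => //; rewrite /= in_itv.
have [d d0 fd] : exists2 d : R, 0 < d &
    forall x y : R, 0 <= x <= 1 -> `|x - y| < d -> `|f x - f y| < e / 2.
  have [|d d0 fd] := compact_unif_continuous cI cf (e := e / 2).
    by rewrite divr_gt0.
  by exists d => // x y xI; apply: fd; rewrite /= in_itv.
(* Chosen so that [c * (k / N - u) ^+ 2] reaches the crude bound [2 * M] once [k / N] is at distance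
   [d] or more from [u]. *)
pose c := 2 * M / d ^+ 2.
have c0 : 0 < c by rewrite divr_gt0 ?mulr_gt0// exprn_gt0.
have [n nc] : exists n : nat, c / n.+1%:R <= e / 2.
  exists (Num.truncn (c / (e / 2))).
  rewrite ler_pdivrMr// mulrC -ler_pdivrMr ?divr_gt0//.
  by rewrite ltW// truncnS_gt.
pose N : R := n.+1%:R.
have N0 : 0 < N by rewrite ltr0n.
exists (bernstein n.+1 (fun k => f (k%:R / N))) => u u01.
have diff k : (k <= n.+1)%N ->
    `|f (k%:R / N) - f u| <= c / N ^+ 2 * (k%:R - N * u) ^+ 2 + e / 2.
  move=> kn.
  have -> : c / N ^+ 2 * (k%:R - N * u) ^+ 2 = c * (k%:R / N - u) ^+ 2.
    by field; rewrite gt_eqF.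
  have [lt_d|ge_d] := ltP `|k%:R / N - u| d.
    rewrite distrC; apply: le_trans (ltW (fd _ _ u01 _)) _; rewrite 1?distrC//.
    by rewrite lerDr mulr_ge0 ?sqr_ge0// ltW.
  have kN : 0 <= k%:R / N <= 1.
    by rewrite divr_ge0 ?ler0n//= ler_pdivrMr// mul1r ler_nat.
  rewrite (le_trans (ler_normB _ _))//.
  have := fM _ u01; have := fM _ kN => h1 h2.
  suff : 2 * M <= c * (k%:R / N - u) ^+ 2.
    by move: (c * _) h1 h2 e0 => C; clear; lra.
  rewrite /c mulrAC ler_pdivlMr ?exprn_gt0// ler_wpM2l ?mulr_ge0 ?(ltW M0)//.
  by rewrite -(real_normK (num_real (k%:R / N - u))) lerXn2r// nnegrE// ltW.
pose V := (bernstein n.+1 (fun k => (k%:R - N * u) ^+ 2)).[u].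
have bnd : c / N ^+ 2 * V <= e / 2.
  (* At the center [N * u] the bias vanishes and only the variance remains. *)
  rewrite /V bernstein_sqr -/N subrr expr0n add0r.
  rewrite (_ : _ * _ = c / N * (u * (1 - u))); last by field; rewrite gt_eqF.
  apply: le_trans nc; rewrite -[leRHS]mulr1 ler_wpM2l//.
    by rewrite ltW// divr_gt0.
  by move: u01 => /andP[u0 u1]; rewrite mulr_ile1 ?subr_ge0// gerBl.
move: (c / N ^+ 2) bnd diff => c' bnd diff; clearbody N; clear c nc c0.
(* Each sign separately: [f (k / N)] lies between two affine functions of the square, and
   [bernstein] preserves order and affine maps. *)
rewrite distrC ler_norml; apply/andP; split.
  have : - c' * V + (f u - e / 2) <=
      (bernstein n.+1 (fun k => f (k%:R / N))).[u].
    rewrite -bernstein_affine; apply: ler_bernstein => // k /diff.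
    by rewrite ler_norml => /andP[+ _]; lra.
  by move: bnd; lra.
have : (bernstein n.+1 (fun k => f (k%:R / N))).[u] <= c' * V + (f u + e / 2).
  rewrite -bernstein_affine; apply: ler_bernstein => // k /diff.
  by rewrite ler_norml => /andP[_ +]; lra.
by move: bnd; lra.
Qed.

(** * Laplace transforms *)

(** Integrating over the half line keeps the integrand at most 1 for [t >= 0]; the laws considered
    have no mass elsewhere. *)
Definition laplace (R : realType) (P : probability (measurableTypeR R) R)
    (t : R) : R :=
  \int[P]_(x in `[0, +oo[) expR (- (t * x)).

(** Change of variables holds with the Radon-Nikodym derivative, which agrees almost everywhere with
    the density since both have the same integral over every measurable set. *)
Lemma ge0_integral_standard_exponential (R : realType)
    (f : measurableTypeR R -> \bar R) :
  (forall x, 0 <= f x)%E -> measurable_fun [set: measurableTypeR R] f ->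
  (\int[standard_exponential R]_x f x =
   \int[lebesgue_measure]_x (f x * (exponential_pdf 1 x)%:E))%E.
Proof.
move=> f0 mf.
have mpdf : measurable_fun [set: R] (fun x : R => (exponential_pdf 1 x)%:E).
  by apply: measurableT_comp => //; exact: measurable_exponential_pdf.
have dom : standard_exponential R `<< (@lebesgue_measure R).
  apply/null_content_dominatesP => B mB B0.
  apply: null_set_integral => //; exact: measurable_funTS.
rewrite -(Radon_Nikodym_SigmaFinite.change_of_variables dom)//.
have iRN := Radon_Nikodym_SigmaFinite.f_integrable dom.
apply: ae_eq_integral => //.
- by apply: emeasurable_funM => //; exact: measurable_int iRN.
- exact: emeasurable_funM.
apply: ae_eqe_mul2l; apply: integral_ae_eq => //.
by move=> E _ mE; rewrite -Radon_Nikodym_SigmaFinite.f_integral.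
Qed.

Lemma standard_exponential_lt0 (R : realType) :
  standard_exponential R `]-oo, 0[%classic = 0%E.
Proof.
apply: integral0_eq => x; rewrite /= in_itv/= => x0.
by rewrite lt0_exponential_pdf.
Qed.

(** Up to the factor [(1 + t)^-1], the damped density is the exponential density of rate [1 + t],
    whose total mass is 1. *)
Lemma laplace_standard_exponential (R : realType) (t : R) : 0 < t ->
  laplace (standard_exponential R) t = (1 + t)^-1.
Proof.
move=> t0; rewrite /laplace /Rintegral.
have t1 : 0 < 1 + t by rewrite addr_gt0.
have mexp : measurable_fun [set: measurableTypeR R]
    (fun x : R => (expR (- (t * x)))%:E).
  apply: measurableT_comp => //; apply: measurableT_comp => //.
  by apply: measurable_funN; exact: mulrl_measurable.
rewrite integral_mkcond ge0_integral_standard_exponential; last 2 first.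
- by move=> x; rewrite erestrict_ge0// => y _; rewrite lee_fin expR_ge0.
- by apply/(measurable_restrictT _ _).1 => //; exact: measurable_funTS.
rewrite (eq_integral (fun x : measurableTypeR R =>
    ((1 + t)^-1)%:E * (exponential_pdf (1 + t) x)%:E)%E); last first.
  move=> x _; rewrite patchE; case: ifPn => [|].
    rewrite inE/= in_itv/= andbT => x0.
    rewrite !exponential_pdfE// -!EFinM mul1r mulrA mulVf ?gt_eqF// mul1r.
    rewrite -expRD.
    by congr (expR _)%:E; ring.
  rewrite notin_setE/= in_itv/= andbT => /negP; rewrite -ltNge => x0.
  by rewrite !lt0_exponential_pdf// !mule0.
rewrite ge0_integralZl//.
- by rewrite integral_exponential_pdf// mule1.
- by apply: measurableT_comp => //; exact: measurable_exponential_pdf.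
- by move=> x _; rewrite lee_fin exponential_pdf_ge0// ltW.
- by rewrite lee_fin invr_ge0 ltW.
Qed.

Lemma bounded_integrable (d : measure_display) (X : measurableType d)
    (R : realType) (P : probability X R) (D : set X) (f : X -> R) (C : R) :
  measurable D -> measurable_fun D f -> (forall x, D x -> `|f x| <= C) ->
  P.-integrable D (EFin \o f).
Proof.
move=> mD mf fC; apply: measurable_bounded_integrable => //.
  by rewrite (le_lt_trans (probability_le1 P mD)) ?ltry.
exists C; split; first exact: num_real.
by move=> M CM x Dx; rewrite /= (le_trans (fC x Dx))// ltW.
Qed.

(** * Continuity theorem for Laplace transforms on the half line *)

Section nonnegative_support.
Context (R : realType).
Implicit Types (P : probability (measurableTypeR R) R) (f : R -> R).

Local Notation D := (`[0%R, +oo[%classic : set (measurableTypeR R)).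

Let mD : measurable D.
Proof. exact: measurable_itv. Qed.

Lemma integral_nonnegative_support P f (C : R) : P `]-oo, 0[%classic = 0%E ->
  measurable_fun [set: R] f -> (forall x, `|f x| <= C) ->
  (\int[P]_x (f x)%:E = (\int[P]_(x in D) f x)%:E)%E.
Proof.
move=> P0 mf fC.
have iT : P.-integrable setT (EFin \o f).
  by apply: (@bounded_integrable _ _ _ _ _ _ C) => // x _; exact: fC.
rewrite (@negligible_integral _ _ _ P setT `]-oo, 0[%classic)//.
rewrite setTD setCitvl /Rintegral fineK//.
by apply: integrable_fin_num => //; exact: (integrableS measurableT).
Qed.

Lemma expR_le1 (t x : R) : 0 <= t -> D x -> 0 <= expR (- (t * x)) <= 1.
Proof.
rewrite /= in_itv/= andbT => t0 x0.
by rewrite expR_ge0/= -expR0 ler_expR oppr_le0 mulr_ge0.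
Qed.

Lemma continuous_expRNM (t : R) : continuous (fun x : R => expR (- (t * x))).
Proof.
move=> x; apply: continuous_comp; last exact: continuous_expR.
by apply: cvgN; apply: cvgM; [exact: cvg_cst|exact: cvg_id].
Qed.

Let integrable_on P f (C : R) :
  continuous f -> (forall x, D x -> `|f x| <= C) ->
  P.-integrable D (EFin \o f).
Proof.
move=> cf fC; apply: (@bounded_integrable _ _ _ P D f C) => //.
by apply: measurable_funTS; exact: continuous_measurable_fun.
Qed.

Let integrable_expR P (t : R) : 0 <= t ->
  P.-integrable D (EFin \o (fun x => expR (- (t * x)))).
Proof.
move=> t0; apply: (@integrable_on _ _ 1); first exact: continuous_expRNM.
by move=> x /(expR_le1 t0)/andP[? ?]; rewrite ger0_norm.
Qed.

Let probability_support P : P `]-oo, 0[%classic = 0%E -> P D = 1%E.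
Proof.
move=> P0; have -> : D = ~` `]-oo, 0[%classic by rewrite setCitvl.
by rewrite probability_setC// [X in (_ - X)%E]P0 sube0.
Qed.

Let Rintegral_cst_support P (c : R) : P `]-oo, 0[%classic = 0%E ->
  \int[P]_(x in D) c = c.
Proof.
move=> P0.
by rewrite Rintegral_cst// [X in fine X]probability_support//= mulr1.
Qed.

(** Dominated convergence along [a = 1 / (n + 1)]. It provides a damping factor [exp (- a x)] that
    costs little mass. *)
Lemma laplace_near0 P (e : R) : P `]-oo, 0[%classic = 0%E -> 0 < e ->
  exists2 a : R, 0 < a & 1 - laplace P a <= e.
Proof.
move=> P0 e0.
have m (t : R) : measurable_fun D (fun x : R => (expR (- (t * x)))%:E).
  apply: measurableT_comp => //; apply: measurable_funTS.
  by apply: continuous_measurable_fun; exact: continuous_expRNM.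
have [||||_ _] := @dominated_convergence _ _ _ P D mD
  (fun n x => (expR (- (n.+1%:R^-1 * x)))%:E) (cst 1%E) (cst 1%E)
  (fun n => m _).
- exact: measurable_cst.
- apply: aeW => x Dx; apply: cvg_EFin; first exact: nearW.
  rewrite -[X in _ --> X]expR0.
  apply: continuous_cvg; first exact: continuous_expR.
  rewrite -oppr0; apply: cvgN; rewrite -(mul0r x).
  by apply: cvgMl; exact: cvg_harmonic.
- apply: (@integrable_on _ (cst 1) 1) => [x|x _]; first exact: cvg_cst.
  by rewrite normr1.
- apply: aeW => x n Dx; rewrite lee_fin ger0_norm ?expR_ge0//.
  by have /(_ n.+1%:R^-1)/(_ _)/andP[] := @expR_le1 _ x _ Dx.
rewrite integral_cst// [X in (_ * X)%E]probability_support// mule1.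
move=> /fine_cvg/cvgrPdist_le/(_ _ e0)[n _ /(_ n (leqnn n))] /= H.
exists n.+1%:R^-1; first by rewrite invr_gt0.
by apply: le_trans H; exact: ler_norm.
Qed.

Lemma poly_bounded01 (p : {poly R}) :
  exists M : R, forall u : R, 0 <= u <= 1 -> `|p.[u]| <= M.
Proof.
elim/poly_ind: p => [|p c [M HM]].
  by exists 0 => u _; rewrite horner0 normr0.
exists (M + `|c|) => u u01; rewrite !hornerE.
rewrite (le_trans (ler_normD _ _))// lerD// normrM.
rewrite -[leRHS]mulr1 ler_pM// ?HM//.
by case/andP: u01 => u0 u1; rewrite ger0_norm.
Qed.

Let continuous_horner_expR (p : {poly R}) (a : R) :
  continuous (fun x : R => p.[expR (- (a * x))]).
Proof.
move=> x.
apply: (@continuous_comp R R R (fun x => expR (- (a * x))) (horner p)).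
  exact: continuous_expRNM.
exact: continuous_horner.
Qed.

(** Powers of [exp (- a x)] are exponentials at multiples of [a], so the integral is a finite
    combination of Laplace transforms. *)
Lemma cvg_laplace_poly (P_ : nat -> probability (measurableTypeR R) R) P
    (a : R) (p : {poly R}) :
  (forall n, P_ n `]-oo, 0[%classic = 0%E) -> P `]-oo, 0[%classic = 0%E ->
  (forall t : R, 0 < t -> laplace (P_ n) t @[n --> \oo] --> laplace P t) ->
  0 < a ->
  \int[P_ n]_(x in D) p.[expR (- (a * x))] @[n --> \oo] -->
  \int[P]_(x in D) p.[expR (- (a * x))].
Proof.
move=> Pn0 P0 LP a0.
(* The extra power [k] makes the induction work: removing the constant term of [p * 'X + c%:P] turns
   its ['X] into one more power. *)
pose I (Q : probability (measurableTypeR R) R) k (q : {poly R}) : R :=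
  \int[Q]_(x in D) (expR (- (a * x)) ^+ k * q.[expR (- (a * x))]).
suff H k : I (P_ n) k p @[n --> \oo] --> I P k p.
  have I0 Q : I Q 0%N p = \int[Q]_(x in D) p.[expR (- (a * x))].
    by apply: eq_Rintegral => x _; rewrite expr0 mul1r.
  by have := H 0%N; rewrite I0; under eq_fun do rewrite I0.
elim/poly_ind: p k => [|p c IH] k.
  have I0 Q : I Q k 0 = 0.
    rewrite /I; under eq_Rintegral do rewrite horner0 mulr0.
    by rewrite Rintegral_cst// mul0r.
  by rewrite I0; under eq_fun do rewrite I0; exact: cvg_cst.
have split_ (Q : probability (measurableTypeR R) R) :
    Q `]-oo, 0[%classic = 0%E ->
    I Q k (p * 'X + c%:P) = I Q k.+1 p + c * laplace Q (k%:R * a).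
  move=> Q0; have [M HM] := poly_bounded01 p.
  have ka : 0 <= k%:R * a by rewrite mulr_ge0// ltW.
  rewrite /laplace -RintegralZl//; last exact: integrable_expR.
  rewrite -RintegralD//.
  - apply: eq_Rintegral => x _.
    by rewrite -mulrA -(mulrN k%:R) expRM_natl !hornerE exprS; ring.
  - apply: (@integrable_on _ _ M).
      move=> x; apply: cvgM.
        apply: (@continuous_comp R R R (fun x => expR (- (a * x)))
          (fun u => u ^+ k.+1)); first exact: continuous_expRNM.
        exact: exprn_continuous.
      exact: continuous_horner_expR.
    move=> x Dx; have u01 := expR_le1 (ltW a0) Dx; have /andP[u0 u1] := u01.
    rewrite normrM -[leRHS]mul1r ler_pM// ?HM//.
    by rewrite ger0_norm ?exprn_ge0// exprn_ile1.
  - apply: (@integrable_on _ _ `|c|).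
      by move=> x; apply: cvgM; [exact: cvg_cst|exact: continuous_expRNM].
    move=> x Dx; have /andP[u0 u1] := expR_le1 ka Dx.
    by rewrite normrM -[leRHS]mulr1 ler_pM// ger0_norm.
rewrite split_//.
under eq_fun do rewrite split_//.
apply: cvgD; first exact: IH.
apply: cvgMr.
(* At [k = 0] the transform is taken at 0, outside the range of the hypothesis, but there it is the
   total mass 1. *)
case: k {split_} => [|k]; last by apply: LP; rewrite mulr_gt0.
have EQ (Q : probability (measurableTypeR R) R) : Q `]-oo, 0[%classic = 0%E ->
    laplace Q (0%:R * a) = 1.
  move=> Q0; rewrite /laplace; under eq_Rintegral do rewrite !mul0r oppr0 expR0.
  exact: Rintegral_cst_support.
by rewrite EQ//; under eq_fun do rewrite EQ//; exact: cvg_cst.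
Qed.

(* [f x * exp (- a x)] is [h (exp (- a x))] for [h u = u f (- ln u / a)], which
   extends continuously by [0] at [0] because [f] is bounded. *)
Lemma damped_approx f (C a e : R) : continuous f -> (forall x, `|f x| <= C) ->
  0 < a -> 0 < e ->
  exists p : {poly R}, forall x, 0 <= x ->
    `|f x - p.[expR (- (a * x))]| <= C * (1 - expR (- (a * x))) + e.
Proof.
move=> cf fC a0 e0.
pose h (u : R) : R := if 0 < u then u * f (- (ln u / a)) else 0.
have hC u : `|h u| <= C * `|u|.
  rewrite /h; case: ifPn => _; first by rewrite normrM mulrC ler_wpM2r.
  by rewrite normr0 mulr_ge0// (le_trans _ (fC 0)).
have ch : continuous h.
  move=> u; have [u0|u0|->] := ltgtP u 0.
  - have : cst (0 : R) x @[x --> u] --> h u.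
      by rewrite /h ltNge (ltW u0); exact: cvg_cst.
    apply: cvg_trans; apply: near_eq_cvg.
    near=> v; rewrite /h/= ifF//; apply/negbTE; rewrite -leNgt.
    by near: v; exact: lt_le_nbhsl.
  - have : v * f (- (ln v / a)) @[v --> u] --> h u.
      rewrite /h u0; apply: cvgM; first exact: cvg_id.
      apply: continuous_cvg; first exact: cf.
      apply: cvgN; apply: cvgMl; exact: continuous_ln.
    apply: cvg_trans; apply: near_eq_cvg.
    by near=> v; rewrite /h/= ifT//; near: v; exact: lt_nbhsr.
  have h0 : h 0 = 0 by rewrite /h ltxx.
  rewrite /continuous_at h0; apply/cvgr0Pnorm_le => r r0.
  have C0 : 0 <= C by rewrite (le_trans _ (fC 0)).
  (* [C] may be 0, so [C + 1] serves as the divisor. *)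
  have C1 : 0 < C + 1 by rewrite ltr_wpDl.
  near=> v; rewrite (le_trans (hC _))//.
  have vr : `|v| <= r / (C + 1).
    by near: v; apply: (@nbhs0_le _ R); rewrite divr_gt0.
  rewrite (le_trans (ler_wpM2l C0 vr))// mulrCA ger_pMr// ler_pdivrMr// mul1r.
  by rewrite lerDl.
have [p hp] := weierstrass_approx ch e0.
exists p => x x0; set u := expR _.
have u0 : 0 < u by rewrite expR_gt0.
have u1 : u <= 1 by rewrite -expR0 ler_expR oppr_le0 mulr_ge0// ltW.
have hu : h u = u * f x.
  by rewrite /h u0 /u expRK mulNr opprK mulrAC divff ?mul1r// gt_eqF.
(* The part [f x * (1 - u)] lost by damping gives the first term of the bound; the damped part
   [u * f x] is [h u], which [p] approximates. *)
have -> : f x - p.[u] = f x * (1 - u) + (h u - p.[u]) by rewrite hu; ring.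
rewrite (le_trans (ler_normD _ _))// lerD//; last by rewrite hp// u1 ltW.
by rewrite normrM (@ger0_norm _ (1 - u)) ?subr_ge0// ler_wpM2r// subr_ge0.
Unshelve. all: by end_near. Qed.

(** For the converse, [f] is replaced by a polynomial in [exp (- a x)], whose integrals converge.
    The replacement error is controlled by [1 - laplace _ a], small for the limit law by the choice
    of [a] and then for [P_ n] by convergence at [a]. *)
Lemma laplace_continuity (P_ : nat -> probability (measurableTypeR R) R) P :
  (forall n, P_ n `]-oo, 0[%classic = 0%E) -> P `]-oo, 0[%classic = 0%E ->
  weak_cvg P_ P <->
  forall t : R, 0 < t -> laplace (P_ n) t @[n --> \oo] --> laplace P t.
Proof.
move=> Pn0 P0; split => [PP t t0|LP f cf bf].
  (* The exponential is unbounded on the negative reals; the truncation makes it an admissible test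
     function and changes nothing on the half line. *)
  pose g (x : R) := expR (- (t * Num.max x 0)).
  have g1 x : `|g x| <= 1.
    rewrite ger0_norm ?expR_ge0// -expR0 ler_expR oppr_le0 mulr_ge0 ?(ltW t0)//.
    by rewrite le_max lexx orbT.
  have cg : continuous g.
    move=> x; apply: (@continuous_comp R R R (id \max cst 0)
      (fun x => expR (- (t * x)))).
      by apply: (@continuous_max _ _ id (cst 0)) => //; exact: cvg_cst.
    exact: continuous_expRNM.
  have gE (Q : probability (measurableTypeR R) R) :
      Q `]-oo, 0[%classic = 0%E ->
      (\int[Q]_x (g x)%:E = (laplace Q t)%:E)%E.
    move=> Q0; rewrite (integral_nonnegative_support (C := 1))//; last first.
      exact: continuous_measurable_fun.
    congr EFin; apply: eq_Rintegral => x; rewrite inE/= in_itv/= andbT => x0.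
    by rewrite /g max_l.
  have := PP g cg; rewrite gE// => /(_ _)/fine_cvg.
  rewrite (_ : fine \o _ = fun n => laplace (P_ n) t); last first.
    by apply/funext => n /=; rewrite gE.
  apply; exists 1; split; first exact: num_real.
  by move=> M M1 x _; rewrite /= (le_trans (g1 x))// ltW.
have [C C0 fC] : exists2 C : R, 0 < C & forall x, `|f x| <= C.
  have [M [Mr HM]] := bf; exists (`|M| + 1); first by rewrite ltr_wpDl.
  move=> x; apply: (HM (`|M| + 1)) => //.
  by rewrite (le_lt_trans (ler_norm _))// ltrDl.
have mf := continuous_measurable_fun cf.
rewrite (integral_nonnegative_support P0 mf fC).
under eq_fun do rewrite (integral_nonnegative_support (Pn0 _) mf fC).
apply: cvg_EFin; first exact: nearW.
apply/cvgrPdist_le => e e0 /=.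
(* The replacement costs at most [2 b] under [P] and [3 b] under [P_ n], and the polynomial
   integrals differ by at most [b]: [6 b] in all. *)
pose b := e / 8.
have b0 : 0 < b by rewrite divr_gt0.
have [a a0 aP] := laplace_near0 P0 (divr_gt0 b0 C0).
have [p fp] := damped_approx cf fC a0 b0.
have fpQ (Q : probability (measurableTypeR R) R) : Q `]-oo, 0[%classic = 0%E ->
    `|\int[Q]_(x in D) f x - \int[Q]_(x in D) p.[expR (- (a * x))]| <=
    C * (1 - laplace Q a) + b.
  move=> Q0; have [M HM] := poly_bounded01 p.
  have ifQ : Q.-integrable D (EFin \o f) by apply: (@integrable_on _ _ C).
  have ipQ : Q.-integrable D (EFin \o (fun x => p.[expR (- (a * x))])).
    apply: (@integrable_on _ _ M); first exact: continuous_horner_expR.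
    by move=> x Dx; exact: HM (expR_le1 (ltW a0) Dx).
  have i1 : Q.-integrable D (EFin \o cst 1).
    apply: (@integrable_on _ (cst 1) 1) => [x|x _]; first exact: cvg_cst.
    by rewrite normr1.
  have ib : Q.-integrable D (EFin \o cst b).
    by apply: (@integrable_on _ (cst b) `|b|) => [x|x _]; [exact: cvg_cst|].
  have iE := @integrable_expR Q a (ltW a0).
  have i2 : Q.-integrable D (EFin \o (fun x => 1 - expR (- (a * x)))).
    by apply: eq_integrable (integrableB _ i1 iE).
  have i3 : Q.-integrable D (EFin \o (fun x => C * (1 - expR (- (a * x))))).
    by apply: eq_integrable (integrableZl _ C i2).
  have i4 : Q.-integrable D (EFin \o (fun x => C * (1 - expR (- (a * x))) + b)).
    by apply: eq_integrable (integrableD _ i3 ib).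
  have i5 : Q.-integrable D (EFin \o (fun x => f x - p.[expR (- (a * x))])).
    by apply: eq_integrable (integrableB _ ifQ ipQ).
  rewrite -RintegralB// (le_trans (le_normr_Rintegral _ i5))//.
  (* The constants [b] and 1 are written as integrals, the total mass being 1, so that the pointwise
     bound can be integrated. *)
  rewrite -[X in _ <= _ + X](Rintegral_cst_support b Q0).
  rewrite -[X in C * (X - _)](Rintegral_cst_support 1 Q0).
  rewrite -RintegralB// -RintegralZl// -RintegralD//.
  apply: le_Rintegral => //.
  - exact: integrable_norm i5.
  - by move=> x; rewrite /= in_itv/= andbT => /fp.
have /cvgrPdist_le/(_ _ b0) cp := cvg_laplace_poly (p := p) Pn0 P0 LP a0.
have /cvgrPdist_le/(_ _ (divr_gt0 b0 C0)) cl := LP a a0.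
near=> n.
have h1 := fpQ _ (Pn0 n).
have h2 := fpQ _ P0.
have h3 : `|\int[P]_(x in D) p.[expR (- (a * x))] -
    \int[P_ n]_(x in D) p.[expR (- (a * x))]| <= b.
  by near: n.
have h4 : C * (1 - laplace P a) <= b by rewrite mulrC -ler_pdivlMr.
(* Convergence at the single point [a] plays the part of tightness. *)
have h5 : C * (1 - laplace (P_ n) a) <= b + b.
  have : `|laplace P a - laplace (P_ n) a| <= b / C by near: n.
  rewrite ler_norml => /andP[_]; rewrite ler_pdivlMr// => H.
  by have := lerD h4 H; rewrite (mulrC (_ - _)) -mulrDr addrA subrK.
have -> : e = b *+ 8 by rewrite /b -mulr_natr divfK.
clearbody b.
move: h1 h2 h3 h4 h5.
move: (\int[P]_(x in D) f x) (\int[P_ n]_(x in D) f x)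
  (\int[P]_(x in D) _) (\int[P_ n]_(x in D) _) => x1 x2 x3 x4.
rewrite !ler_norml => /andP[? ?] /andP[? ?] /andP[? ?] ? ?.
by apply/andP; split; lra.
Unshelve. all: by end_near. Qed.

End nonnegative_support.

(** * Hitting times *)

Section hitting.
Context (d : measure_display) (X : measurableType d) (R : realType).
Variables (mu : probability X R) (T : {mfun X >-> X}).
Hypotheses (Tpres : measure_preserving mu T) (Terg : ergodic mu T).
Variables (A : set X) (mA : measurable A) (A_gt0 : (0 < mu A)%E).

(* The event that the hitting time exceeds [k]. *)
Definition survivor (k : nat) : set X :=
  \bigcap_(i < k) (iter i.+1 T @^-1` ~` A).

Let mpre k (B : set X) : measurable B -> measurable (iter k T @^-1` B).
Proof.
by move=> mB; rewrite -[X in measurable X]setTI; exact: measurable_iter.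
Qed.

Lemma measurable_survivor k : measurable (survivor k).
Proof.
by apply: bigcap_measurableType => i _; apply: mpre; exact: measurableC.
Qed.

(** Unlike in [survivor], time 0 counts here and the last time is [k - 1]. *)
Definition avoiding (k : nat) : set X := \bigcap_(i < k) (iter i T @^-1` ~` A).

Lemma measurable_avoiding k : measurable (avoiding k).
Proof.
by apply: bigcap_measurableType => i _; apply: mpre; exact: measurableC.
Qed.

(** The separate value at [k = 0] agrees with the empty intersection, which is the whole space. *)
Lemma sweep_outE k : sweep_out mu T A k = mu (avoiding k).
Proof.
by case: k => //; rewrite /avoiding/= bigcap_mkord big_ord0 probability_setT.
Qed.

Lemma survivorE k : survivor k = T @^-1` avoiding k.
Proof.
apply/seteqP; split => x H i ik; have := H i ik; rewrite /preimage/=.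
  by rewrite -iterSr.
by rewrite -iterSr.
Qed.

Lemma measure_survivor k : mu (survivor k) = sweep_out mu T A k.
Proof.
by rewrite survivorE Tpres ?sweep_outE//; exact: measurable_avoiding.
Qed.

Lemma avoidingS k : avoiding k.+1 = survivor k `\` A.
Proof.
apply/seteqP; split => [x H|x [H nA]].
  by split => [i ik|]; [exact: (H i.+1)|exact: (H 0%N)].
by move=> [_ //|i ik]; exact: H.
Qed.

(** The survivors are split by their position at time 0: those outside [A] avoid it from time 0 to
    [k]. *)
Lemma measure_survivorI k :
  (mu (survivor k `&` A) + sweep_out mu T A k.+1 = sweep_out mu T A k)%E.
Proof.
rewrite -(measure_survivor k) sweep_outE avoidingS.
by rewrite [RHS](measureDI mu (measurable_survivor k) mA) addeC.
Qed.

(** By ergodicity, almost every point visits [A] infinitely often: the set of such points is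
    invariant and has measure at least [mu A > 0]. *)
Lemma never_hit_null : mu (\bigcap_k survivor k) = 0%E.
Proof.
pose U k := \bigcup_(i in [set i | (k <= i)%N]) (iter i T @^-1` A).
have mU k : measurable (U k).
  by apply: bigcup_measurable => i _; exact: mpre.
have TU k : T @^-1` U k = U k.+1.
  apply/seteqP; split => x [i ki H].
    by exists i.+1 => //; rewrite /preimage/= -iterS iterSr.
  case: i ki H => // i ki H; exists i => //.
    by move: H; rewrite /preimage/= -iterS iterSr.
(* The tails [U k] decrease but are preimages of one another, so invariance gives them a common
   measure, inherited by their intersection. *)
have muU k : mu (U k) = mu (U 0%N).
  by elim: k => // k IH; rewrite -TU Tpres.
(* The points visiting [A] infinitely often form a strictly invariant set. *)
pose C := \bigcap_k U k.
have mC : measurable C by exact: bigcap_measurableType.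
have TC : T @^-1` C = C.
  apply/seteqP; split => x H k _.
    have : (T @^-1` U k) x := H k I; rewrite TU => -[i ki Hi].
    by exists i => //; exact: ltnW.
  by have := H k.+1 I; rewrite -TU.
have muC : mu C = mu (U 0%N).
  have /cvg_lim <- // : mu \o U @ \oo --> mu C.
    apply: nonincreasing_cvg_mu => //.
      by rewrite (le_lt_trans (probability_le1 mu (mU 0%N)))// ltry.
    move=> m n mn; apply/subsetPset => x [i ni Hi]; exists i => //.
    exact: leq_trans ni.
  rewrite (_ : mu \o U = cst (mu (U 0%N))); last by apply/funext => k /=.
  by rewrite lim_cst.
have muC1 : mu C = 1%E.
  case: (Terg mC TC) => // mC0; move: A_gt0; rewrite -mC0 muC ltNge.
  by rewrite le_measure ?inE// => x Ax; exists 0%N.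
have : mu (~` C) = 0%E by rewrite probability_setC// muC1 subee.
apply: subset_measure0 => //.
- by apply: bigcap_measurableType => k _; exact: measurable_survivor.
- exact: measurableC.
(* [U 1] is used because a visit at time 0 would not contradict survival. *)
move=> x H /(_ 1%N I)[[//|i] _ Ai].
by have := H i.+1 I i (ltnSn i); apply.
Qed.
(** [K] is the least [i] with a visit at time [i.+1], hence one less than the hitting time. *)
Lemma hitting_time_not_never (x : X) : ~ (\bigcap_k survivor k) x ->
  exists K : nat, (forall k, (k <= K)%N = (x \in survivor k)) /\
    hitting_time R T A x = K.+1%:R%:E.
Proof.
move=> nx; pose P i := `[< A (iter i.+1 T x) >].
have exP : exists i, P i.
  apply: contrapT => noP; apply: nx => k _ i ik; rewrite /preimage/= => Ai.
  by apply: noP; exists i; exact/asboolP.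
have [K PK Kmin] := ex_minnP exP.
exists K; split.
  move=> k; apply/idP/idP => [kK|/set_mem xk].
    apply/mem_set => i ik Ai; have := Kmin i; rewrite leqNgt (leq_trans ik kK).
    by move=> /(_ (asboolT Ai)).
  by rewrite leqNgt; apply/negP => Kk; exact: (xk K Kk (asboolW PK)).
apply/eqP; rewrite eq_le; apply/andP; split.
  by apply: ereal_inf_lbound; exists K.+1 => //; split => //; exact/asboolP.
apply: le_ereal_inf_tmp => _ [[|k] [//= _ Ak] <-].
by rewrite lee_fin ler_nat ltnS Kmin//; exact/asboolP.
Qed.

(** * Laplace transforms of the hitting and return times *)

Local Notation m := (fine (mu A)).
Local Notation tau := (normalized_hitting_time mu T mA).

Lemma normalized_hitting_time_ge0 x : 0 <= tau x.
Proof.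
apply/fine_ge0/mule_ge0 => //; apply: le_ereal_inf_tmp => _ [k _ <-].
by rewrite lee_fin.
Qed.

Lemma distribution_hitting_lt0 (nu : probability X R) :
  distribution nu tau `]-oo, 0[%classic = 0%E.
Proof.
rewrite /distribution /pushforward (_ : _ @^-1` _ = set0) ?measure0//.
apply/seteqP; split => // x; rewrite /preimage/= in_itv/= ltNge.
by rewrite normalized_hitting_time_ge0.
Qed.

Let m_gt0 : 0 < m.
Proof.
by rewrite fine_gt0// A_gt0 (le_lt_trans (probability_le1 mu mA))// ltry.
Qed.

Let mE : m%:E = mu A.
Proof. by rewrite fineK// fin_num_measure. Qed.

(** The indicators cut the series after [k = K]; what remains is a finite geometric sum of ratio
    [exp (- m t)], and [tau x] is [m * K.+1]. *)
Lemma geometric_survivor (t : R) (x : X) :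
  0 < t -> ~ (\bigcap_k survivor k) x ->
  ((1 - expR (- (t * tau x)))%:E =
   (1 - expR (- (m * t)))%:E *
   \sum_(0 <= k <oo) (expR (- (m * k%:R * t)))%:E * (\1_(survivor k) x)%:E)%E.
Proof.
move=> t0 /hitting_time_not_never[K [HK tK]].
rewrite (nneseries_split 0 K.+1); last first.
  by move=> k _; rewrite -EFinM lee_fin mulr_ge0// expR_ge0.
rewrite [X in (_ + X)%E]eseries0 ?adde0; last first.
  by move=> k; rewrite add0n => Kk _; rewrite indicE -HK leqNgt Kk mule0.
rewrite add0n.
rewrite (eq_big_nat _ _
  (F2 := fun k => (expR (- (m * t)) ^+ k)%:E)); last first.
  move=> k /andP[_ kK]; rewrite indicE -HK -ltnS kK mule1 -expRM_natl.
  by congr (expR _)%:E; ring.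
rewrite sumEFin -EFinM big_mkord; congr EFin.
have := subrX1 (expR (- (m * t))) K.+1.
rewrite -expRM_natl /normalized_hitting_time tK -mE -EFinM/= => H.
rewrite -opprB -[1 - _ in RHS]opprB mulNr -H; congr (- (expR _ - 1)); ring.
Qed.

(** [geometric_survivor] is integrated, with sum and integral exchanged by nonnegativity. The law
    [nu] is general so as to cover both [mu] and its normalized restriction. *)
Lemma laplace_distribution_hitting (nu : probability X R) (t : R) :
  0 < t -> nu (\bigcap_k survivor k) = 0%E ->
  ((1 - laplace (distribution nu tau) t)%:E =
   (1 - expR (- (m * t)))%:E *
   \sum_(0 <= k <oo) (expR (- (m * k%:R * t)))%:E * nu (survivor k))%E.
Proof.
move=> t0 nu0.
have mtau : measurable_fun [set: X] (fun x => expR (- (t * tau x))).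
  apply: (@measurableT_comp _ _ _ _ _ _ (fun y : R => expR (- (t * y)))).
    by apply: continuous_measurable_fun; exact: continuous_expRNM.
  exact: (@measurable_funPT _ _ _ (measurableTypeR R) tau).
have itau : nu.-integrable setT (EFin \o (fun x => expR (- (t * tau x)))).
  apply: (@bounded_integrable _ _ _ _ _ _ 1) => // x _.
  rewrite ger0_norm ?expR_ge0// -expR0 ler_expR oppr_le0.
  by rewrite mulr_ge0 ?normalized_hitting_time_ge0// ltW.
have -> : laplace (distribution nu tau) t = \int[nu]_x expR (- (t * tau x)).
  rewrite /laplace /Rintegral ge0_integral_pushforward//; last first.
    apply: measurableT_comp => //; apply: measurable_funTS.
    by apply: continuous_measurable_fun; exact: continuous_expRNM.
  congr (fine (integral _ _ _)); apply/seteqP; split => // x _.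
  by rewrite /preimage/= in_itv/= normalized_hitting_time_ge0.
have i1 : nu.-integrable setT (EFin \o (cst 1 : X -> R)).
  by apply: (@bounded_integrable _ _ _ _ _ _ 1) => // x _; rewrite normr1.
have i2 : nu.-integrable setT (EFin \o (fun x => 1 - expR (- (t * tau x)))).
  by apply: eq_integrable (integrableB _ i1 itau).
have -> : 1 - \int[nu]_x expR (- (t * tau x)) =
    \int[nu]_x (1 - expR (- (t * tau x))).
  rewrite RintegralB//; congr (_ - _).
  by rewrite Rintegral_cst// [X in fine X]probability_setT mulr1.
rewrite fineK; last exact: integrable_fin_num.
have c_ge0 : 0 <= 1 - expR (- (m * t)).
  by rewrite subr_ge0 -expR0 ler_expR oppr_le0 mulr_ge0// ltW.
have term_ge0 k x :
    (0 <= (expR (- (m * k%:R * t)))%:E * (\1_(survivor k) x)%:E)%E.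
  by rewrite -EFinM lee_fin mulr_ge0// expR_ge0.
have mterm k : measurable_fun [set: X]
    (fun x => (expR (- (m * k%:R * t)))%:E * (\1_(survivor k) x)%:E)%E.
  apply: emeasurable_funM => //; apply: measurableT_comp => //.
  exact: measurable_indic (measurable_survivor k).
have mseries : measurable_fun [set: X] (fun x => \sum_(0 <= k <oo)
    (expR (- (m * k%:R * t)))%:E * (\1_(survivor k) x)%:E)%E.
  exact: ge0_emeasurable_sum.
(* The pointwise identity fails where [A] is never hit: there [fine] makes [tau] equal to 0 while
   every indicator is 1. Hence an almost everywhere argument. *)
transitivity (\int[nu]_x ((1 - expR (- (m * t)))%:E * \sum_(0 <= k <oo)
    (expR (- (m * k%:R * t)))%:E * (\1_(survivor k) x)%:E))%E.
  apply: ae_eq_integral => //.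
  - by apply: measurableT_comp => //; exact: measurable_funB.
  - exact: emeasurable_funM.
  exists (\bigcap_k survivor k); split => //.
    by apply: bigcap_measurableType => k _; exact: measurable_survivor.
  move=> x H; apply: contrapT => nx; apply: H => _.
  exact: geometric_survivor.
rewrite ge0_integralZl//; last by move=> x _; exact: nneseries_ge0.
congr *%E; rewrite integral_nneseries//.
apply: eq_eseriesr => k _; rewrite ge0_integralZl//.
- by rewrite integral_indic ?setIT//; exact: measurable_survivor.
- apply: measurableT_comp => //.
  exact: measurable_indic (measurable_survivor k).
Qed.

Lemma laplace_hitting (t : R) : 0 < t ->
  ((1 - laplace (distribution mu tau) t)%:E =
   (1 - expR (- (m * t)))%:E *
   \sum_(0 <= k <oo) (expR (- (m * k%:R * t)))%:E * sweep_out mu T A k)%E.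
Proof.
move=> t0; rewrite laplace_distribution_hitting//; last exact: never_hit_null.
by congr *%E; apply: eq_eseriesr => k _; rewrite measure_survivor.
Qed.

Lemma normalized_restrictionE (B : set X) :
  normalized_restriction mu mA B = (mu (B `&` A) * (m^-1)%:E)%E.
Proof.
have mT : mrestr mu mA [set: X] = m%:E by rewrite mE /mrestr setTI.
(* The default value would be taken for mass 0 or infinity, both excluded since [m] is positive and
   finite. *)
rewrite /normalized_restriction/= /mnormalize; case: ifPn => [/orP[]/eqP|_].
- by move/(etrans (esym mT)) => -[] /eqP; rewrite gt_eqF.
- by move/(etrans (esym mT)).
by congr (_ * (fine _)^-1%:E)%E; rewrite -mE; exact: mT.
Qed.

(** The sweep-out series is written in two ways in terms of the shifted series [W], and [W] is then
    eliminated. *)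
Lemma laplace_return (t : R) : 0 < t ->
  laplace (distribution (normalized_restriction mu mA) tau) t =
  1 - (expR (m * t) - 1) / m * laplace (distribution mu tau) t.
Proof.
move=> t0; set nu := normalized_restriction mu mA.
have nu0 : nu (\bigcap_k survivor k) = 0%E.
  have mN : measurable (\bigcap_k survivor k).
    by apply: bigcap_measurableType => k _; exact: measurable_survivor.
  rewrite normalized_restrictionE.
  rewrite (subset_measure0 _ mN _ never_hit_null) ?mul0e//.
  exact: measurableI.
have := laplace_distribution_hitting t0 nu0; have := laplace_hitting t0.
set H := laplace _ t; set L := laplace _ t.
(* This [q] is the inverse of the ratio of the series. *)
rewrite expRN; set q := expR (m * t).
have q1 : 1 < q by rewrite expR_gt1 mulr_gt0.
have q0 : 0 < q by rewrite expR_gt0.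
(* A finite product with a positive factor forces the series to be finite, so the rest is real
   algebra. *)
have fin (c r : R) (x : \bar R) :
    0 < c -> (r%:E = c%:E * x -> x = (r / c)%:E)%E.
  move=> c0; case: x => [x|/=|/=].
  - by move=> [->]; rewrite mulrAC divff ?mul1r// gt_eqF.
  - by rewrite gt0_muley ?lte_fin.
  - by rewrite gt0_muleNy ?lte_fin.
pose w k : R := expR (- (m * k%:R * t)).
have w0 k : (0 <= (w k)%:E)%E by rewrite lee_fin expR_ge0.
have s0 k : (0 <= sweep_out mu T A k)%E by rewrite sweep_outE.
have c0 : 0 < 1 - q^-1 by rewrite subr_gt0 invf_lt1.
move=> /(fin _ _ _ c0) SE /(fin _ _ _ c0) VE.
pose W := (\sum_(0 <= k <oo) (w k)%:E * sweep_out mu T A k.+1)%E.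
(* First way: the term [k = 0], equal to 1, is split off and the index shifted, which costs one
   factor [q^-1]. *)
have : ((1 - H) / (1 - q^-1))%:E = (1 + (q^-1)%:E * W)%E.
  rewrite -SE nneseries_recl//; last by move=> k _; exact: mule_ge0.
  rewrite mulr0 mul0r oppr0 expR0 mul1e; congr (_ + _)%E.
  rewrite -nneseries_addn; last by move=> k; exact: mule_ge0.
  rewrite /W -nneseriesZl; last by move=> k _; exact: mule_ge0.
  apply: eq_eseriesr => k _; rewrite addn1 muleA -EFinM -expRN -expRD.
  by congr ((expR _)%:E * _)%E; rewrite -natr1; ring.
(* Second way: termwise by [measure_survivorI], the factor [m] undoing the normalization of [nu]. *)
have : ((1 - H) / (1 - q^-1))%:E = (m%:E * ((1 - L) / (1 - q^-1))%:E + W)%E.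
  rewrite -SE -VE -nneseriesZl; last by move=> k _; exact: mule_ge0.
  rewrite -nneseriesD => [| |]; last 2 first.
  - by move=> k _ _; rewrite mule_ge0 ?lee_fin ?(ltW m_gt0)// mule_ge0.
  - by move=> k _ _; exact: mule_ge0.
  apply: eq_eseriesr => k _.
  rewrite normalized_restrictionE muleCA (muleCA m%:E) -EFinM.
  rewrite divff ?gt_eqF// mule1.
  by rewrite -ge0_muleDr// measure_survivorI.
case: W => [W|/=|/=]; last 2 first.
- by rewrite -EFinM.
- by rewrite -EFinM.
rewrite -!EFinM -!EFinD => -[E1] -[E2].
have q_neq0 : q != 0 by rewrite gt_eqF.
have m_neq0 : m != 0 by rewrite gt_eqF.
have c_neq0 : q - 1 != 0 by rewrite gt_eqF// subr_gt0.
have WE : W = q * ((1 - H) / (1 - q^-1) - 1).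
  by rewrite E2 addrAC subrr add0r mulrA divff// mul1r.
have LE : 1 - L = (1 - q^-1) / m * ((1 - H) / (1 - q^-1) - W).
  by rewrite E1 addrK; field; rewrite q_neq0 c_neq0 m_neq0.
by rewrite -[LHS](subKr 1) LE WE; field; rewrite q_neq0 c_neq0 m_neq0.
Qed.
End hitting.

(** * Limits *)

(** Squeezed between [t] and [t * expR (m n * t)]: both bounds come from [1 + x <= expR x], at
    [x = m n * t] and at its opposite. *)
Lemma cvg_expR_slope (R : realType) (m : nat -> R) (t : R) : 0 < t ->
  (forall n, 0 < m n) -> m n @[n --> \oo] --> 0 ->
  (expR (m n * t) - 1) / m n @[n --> \oo] --> t.
Proof.
move=> t0 m0 mcvg.
have ecvg : t * expR (m n * t) @[n --> \oo] --> t.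
  rewrite -[X in _ --> X]mulr1; apply: cvgMr.
  rewrite -expR0 -(mul0r t).
  apply: continuous_cvg; first exact: continuous_expR.
  exact: cvgMl.
apply: (squeeze_cvgr _ (cvg_cst t) ecvg); apply: nearW => n.
rewrite ler_pdivlMr// ler_pdivrMr//; apply/andP; split.
  by have := expR_ge1Dx (m n * t); lra.
have := expR_ge1Dx (- (m n * t)); rewrite -(ler_pM2r (expR_gt0 (m n * t))).
by rewrite -expRD addNr expR0 mulrDl mul1r mulNr; lra.
Qed.

Theorem theorem1 (d : measure_display) (X : measurableType d) (R : realType)
    (mu : probability X R) (T : {mfun X >-> X})
    (Tpres : measure_preserving mu T) (Terg : ergodic mu T)
    (A : nat -> set X) (mA : forall n, measurable (A n))
    (A_gt0 : forall n, (0 < mu (A n))%E)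
    (A_cvg0 : mu (A n) @[n --> \oo] --> 0%E) :
  [<-> weak_cvg
         (fun n => distribution (normalized_restriction mu (mA n))
                     (normalized_hitting_time mu T (mA n)))
         (standard_exponential R);
       weak_cvg
         (fun n => distribution mu (normalized_hitting_time mu T (mA n)))
         (standard_exponential R);
       forall t : R, 0 < t ->
         ((1 - expR (- (fine (mu (A n)) * t)))%:E *
          \sum_(0 <= k <oo) (expR (- (fine (mu (A n)) * k%:R * t)))%:E *
            sweep_out mu T (A n) k)%E @[n --> \oo] --> (t / (t + 1))%:E ].
Proof.
pose H n t := laplace (distribution mu (normalized_hitting_time mu T (mA n))) t.
pose L n t := laplace (distribution (normalized_restriction mu (mA n))
  (normalized_hitting_time mu T (mA n))) t.
pose m n := fine (mu (A n)).
have mE n : (m n)%:E = mu (A n) by rewrite fineK// fin_num_measure.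
have m_gt0 n : 0 < m n by rewrite -lte_fin mE.
have m_cvg0 : m n @[n --> \oo] --> 0 by exact: fine_cvg A_cvg0.
pose c n t := (expR (m n * t) - 1) / m n.
have c_cvg t : 0 < t -> c n t @[n --> \oo] --> t.
  by move=> t0; exact: cvg_expR_slope.
have LE n t : 0 < t -> L n t = 1 - c n t * H n t by exact: laplace_return.
have L1 t : 0 < t -> laplace (standard_exponential R) t = (1 + t)^-1 :=
  @laplace_standard_exponential R t.
have t1_neq0 (t : R) : 0 < t -> 1 + t != 0.
  by move=> t0; rewrite gt_eqF// addr_gt0.
have weak1 := laplace_continuity (fun n => distribution_hitting_lt0
  mu T (mA n) (normalized_restriction mu (mA n))) (standard_exponential_lt0 R).
have weak2 := laplace_continuity (fun n => distribution_hitting_lt0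
  mu T (mA n) mu) (standard_exponential_lt0 R).
tfae.
- move=> /weak1 cvgL; apply/weak2 => t t0.
  (* The limit is put in the form of [H = (1 - L) / c], the relation [LE] solved for [H]; the limit
     [t] of [c] is nonzero. *)
  have -> : laplace (standard_exponential R) t = (1 - (1 + t)^-1) / t.
    by rewrite L1//; field; rewrite t1_neq0// gt_eqF.
  rewrite (_ : (fun n => _) = (fun n => (1 - L n t) / c n t)).
    apply: cvgM; last by apply: cvgV; [rewrite gt_eqF|exact: c_cvg].
    by apply: cvgB; [exact: cvg_cst|rewrite -L1//; exact: cvgL].
  apply/funext => n; rewrite LE// opprB addrC subrK mulrAC divff ?mul1r//.
  rewrite gt_eqF// divr_gt0// subr_gt0 expR_gt1 mulr_gt0//.
- move=> /weak2 cvgH t t0.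
  under eq_fun do rewrite -laplace_hitting//.
  apply: cvg_EFin; first exact: nearW.
  have -> : t / (t + 1) = 1 - (1 + t)^-1.
    by rewrite addrC; field; rewrite t1_neq0.
  by apply: cvgB; [exact: cvg_cst|rewrite -L1//; exact: cvgH].
- move=> cvgS; apply/weak1 => t t0.
  have : 1 - H n t @[n --> \oo] --> t / (t + 1).
    have := cvgS t t0; under eq_fun do rewrite -laplace_hitting//.
    exact: fine_cvg.
  move=> cvgH.
  (* The limit now has the form of [L = 1 - c * (1 - (1 - H))], since [1 - H] is the quantity known
     to converge. *)
  have -> : laplace (standard_exponential R) t = 1 - t * (1 - t / (t + 1)).
    by rewrite L1// [t + 1]addrC; field; rewrite t1_neq0.
  rewrite (_ : (fun n => _) =
      (fun n => 1 - c n t * (1 - (1 - H n t)))); last first.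
    by apply/funext => n; rewrite subKr -LE.
  apply: cvgB; first exact: cvg_cst.
  apply: cvgM; first exact: c_cvg.
  by apply: cvgB => //; exact: cvg_cst.
Qed.
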